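(* Let $G$ be a finite group with center $Z(G)$. (i) If $p$ is a prime and $G/Z(G)\cong \mathbb{Z}_p\times\mathbb{Z}_p$, then $\mathcal{E}(\Gamma_G)=2\big((p^2-1)|Z(G)|-p-1\big)$. (ii) If $m\ge 2$ is a natural number and $G/Z(G)\cong D_{2m}$, then $\mathcal{E}(\Gamma_G)=2\big((2m-1)|Z(G)|-m-1\big)$.
   Context: For a finite non-Abelian group $G$ with center $Z(G)$, the commuting graph $\Gamma_G$ is the simple undirected graph with vertex set $G\setminus Z(G)$ in which two distinct vertices $a,b$ are adjacent iff $ab=ba$. The energy $\mathcal{E}(\Gamma)$ of a finite graph $\Gamma$ is the sum of the absolute values of the eigenvalues of its adjacency matrix, counted with multiplicity. $D_{2m}=\langle a,b \mid a^m=b^2=1,\ bab^{-1}=a^{-1}\rangle$ is the dihedral group of order $2m$ (with $D_4\cong\mathbb{Z}_2\times\mathbb{Z}_2$). *)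

(* Defs.v *)
From HB Require Import structures.
From mathcomp Require Import all_boot all_order all_algebra.
From mathcomp Require Import all_fingroup all_solvable.

Set Implicit Arguments.
Unset Strict Implicit.
Unset Printing Implicit Defensive.

Import GRing.Theory Num.Theory.

Record sgraph := SGraph {
  vertex : finType;
  adj : rel vertex;
  adj_sym : symmetric adj;
  adj_irrefl : irreflexive adj
}.

Section Energy.
Local Open Scope ring_scope.

(* Vertices are indexed by their rank in the enumeration of the vertex type;
   the matrix may be 0 x 0. *)
Definition adjmx (R : pzSemiRingType) (X : sgraph) : 'M[R]_#|vertex X| :=
  \matrix_(i, j) (adj (enum_val i) (enum_val j))%:R.

(* The roots of the characteristic polynomial, listed with algebraic
   multiplicity (in an unspecified order). *)
Definition eigenvalues (C : closedFieldType) n (A : 'M[C]_n) : seq C :=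
  sval (closed_field_poly_normal (char_poly A)).

Lemma eigenvaluesP (C : closedFieldType) n (A : 'M[C]_n) :
  char_poly A = \prod_(z <- eigenvalues A) ('X - z%:P).
Proof.
rewrite /eigenvalues; case: closed_field_poly_normal => s /=.
by rewrite (monicP (char_poly_monic A)) scale1r.
Qed.

(* A [numClosedFieldType] is an algebraically closed field of characteristic 0
   with a complex modulus [`|z|], such as [algC] or the complex numbers. *)
Definition energy (C : numClosedFieldType) (X : sgraph) : C :=
  \sum_(z <- eigenvalues (adjmx C X)) `|z|.

End Energy.

Section CommutingGraph.
Local Open Scope group_scope.
Variables (gT : finGroupType) (G : {group gT}).

Definition noncentral : finType := {x : gT | x \in G :\: 'Z(G)}.

Definition commuting_adj : rel noncentral :=
  fun a b => (a != b) && (val a * val b == val b * val a).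

Lemma commuting_adj_sym : symmetric commuting_adj.
Proof. by move=> a b; rewrite /commuting_adj eq_sym [_ * _ == _]eq_sym. Qed.

Lemma commuting_adj_irrefl : irreflexive commuting_adj.
Proof. by move=> a; rewrite /commuting_adj eqxx. Qed.

Definition commuting_graph : sgraph :=
  SGraph commuting_adj_sym commuting_adj_irrefl.

End CommutingGraph.

(* Main.v *)
(* When G has an abelian normal subgroup A of prime index p, the centralizer of
   a noncentral x is A if x lies in A, and otherwise meets A in Z(G) and has
   order p|Z(G)|; in both cases it is abelian. So commuting is an equivalence
   relation on G \ Z(G), whose classes are the sets C_G(x) \ Z(G), and counting
   elements shows that there are 1 + |A : Z(G)| of them. The graph is thus a
   disjoint union of k = 1 + |A : Z(G)| cliques on n = |G| - |Z(G)| vertices,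
   and its energy is 2(n - k). For both parts, A is the preimage of a cyclic
   subgroup of prime index in G / Z(G). *)

Require Import Defs.
From mathcomp Require Import all_boot all_order all_algebra.
From mathcomp Require Import all_fingroup all_solvable.
From mathcomp Require Import ring.

Set Implicit Arguments.
Unset Strict Implicit.
Unset Printing Implicit Defensive.

Import GRing.Theory Num.Theory.
Local Open Scope ring_scope.

(** * Spectrum of a disjoint union of cliques *)

(** Division-free form of Sylvester's determinant identity, usable over [{poly C}] with
    [a = 'X + 1]. Clearing the lower left block of [M] by a column operation, then by a row
    operation, gives the two sides. *)
Lemma det_scalar_sub_mulmx (R : comPzRingType) m n (a : R)
    (P : 'M[R]_(m, n)) (Q : 'M[R]_(n, m)) :
  a ^+ n * \det (a%:M - P *m Q) = a ^+ m * \det (a%:M - Q *m P).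
Proof.
pose M := block_mx a%:M P Q 1%:M.
have detM : \det M = \det (a%:M - P *m Q).
  pose L : 'M_(m + n) := block_mx 1%:M 0 (- Q) 1%:M.
  have -> : \det M = \det (M *m L).
    by rewrite det_mulmx det_lblock !det1 !mulr1.
  rewrite mulmx_block !mulmx1 !mul1mx mulmxN !mulmx0 !add0r subrr.
  by rewrite det_ublock det1 mulr1.
pose L : 'M_(m + n) := block_mx 1%:M 0 (- Q) a%:M.
have <- : \det (L *m M) = a ^+ n * \det (a%:M - P *m Q).
  by rewrite det_mulmx det_lblock det1 mul1r det_scalar detM.
rewrite mulmx_block !mul1mx !mul0mx !addr0 mul_mx_scalar mul_scalar_mx.
by rewrite scalerN addNr det_ublock det_scalar mulmx1 mulNmx addrC.
Qed.

(* With P the incidence matrix of the fibers of f, adjacency + 1 = P P^T while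
   P^T P is diagonal, its entries being the fiber sizes; det_scalar_sub_mulmx
   relates their characteristic polynomials. *)
Lemma energy_cluster_graph (C : numClosedFieldType) (X : sgraph) (I : finType)
    (f : vertex X -> I) :
    (forall x y, adj x y = (x != y) && (f x == f y)) ->
  energy C X = 2 * (#|vertex X|%:R - #|f @: vertex X|%:R).
Proof.
move=> adjE; set n := #|vertex X|.
pose fib i := #|[set x | f x == i]|.
pose P : 'M[{poly C}]_(n, #|I|) :=
  \matrix_(i, j) (f (enum_val i) == enum_val j)%:R.
have charE : char_poly (adjmx C X) = \det (('X + 1)%:M - P *m P^T).
  congr (\det _); apply/matrixP=> i j; rewrite !mxE.
  under eq_bigr => k _ do rewrite !mxE.
  rewrite (bigD1 (enum_rank (f (enum_val i)))) //= enum_rankK eqxx mul1r.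
  rewrite big1 ?addr0 => [|k]; last first.
    rewrite -(inj_eq enum_val_inj) enum_rankK eq_sym => /negPf ->.
    by rewrite mul0r.
  rewrite adjE (inj_eq enum_val_inj) [f _ == f _]eq_sym.
  case: eqVneq => [->|_]; last by rewrite !mulr0n polyCMn.
  by rewrite eqxx mulr0n polyC0 subr0 !mulr1n addrK.
have gramE : \det (('X + 1)%:M - P^T *m P) =
    \prod_(z <- [seq (fib i)%:R - 1 | i <- enum I]) ('X - z%:P) :> {poly C}.
  pose d : 'rV[{poly C}]_#|I| :=
    \row_j ('X - ((fib (enum_val j))%:R - 1)%:P).
  rewrite (_ : _ - _ = diag_mx d); last first.
    apply/matrixP=> i j; rewrite !mxE.
    under eq_bigr => k _ do rewrite !mxE.
    case: (eqVneq i j) => [<-|neq_ij]; last first.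
      rewrite big1 ?subr0 // => k _; case: eqP => [->|_]; last by rewrite mul0r.
      by rewrite (inj_eq enum_val_inj) (negPf neq_ij) mulr0.
    rewrite !mulr1n polyCB polyC1 opprB addrA; congr (_ - _).
    rewrite polyC_natr /fib -sum1dep_card natr_sum [RHS]big_mkcond /=.
    rewrite (reindex _ (onW_bij _ (@enum_val_bij (vertex X)))) /=.
    by apply: eq_bigr => k _; case: eqP => _; rewrite ?mulr1 ?mulr0.
  rewrite det_diag big_map big_enum /=.
  rewrite (reindex _ (onW_bij _ (@enum_val_bij I))) /=.
  by apply: eq_bigr => j _; rewrite mxE.
(* The factors [('X + 1) ^+ #|I|] and [('X + 1) ^+ n] of the determinant identity become padding by
   copies of -1, so equal products of linear factors give equal multisets of roots. *)
have key : perm_eq (eigenvalues (adjmx C X) ++ nseq #|I| (-1))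
    (nseq n (-1) ++ [seq (fib i)%:R - 1 | i <- enum I]).
  apply: prod_XsubC_eq.
  rewrite !big_cat !big_nseq !iter_mulr_1 -eigenvaluesP /= charE.
  by rewrite polyCN opprK -gramE mulrC det_scalar_sub_mulmx.
have : \sum_(z <- eigenvalues (adjmx C X) ++ nseq #|I| (-1)) `|z| =
    \sum_(z <- nseq n (-1) ++ [seq (fib i)%:R - 1 | i <- enum I]) `|z|.
  exact: perm_big key.
rewrite !big_cat /= -/(energy C X) !big_nseq !normrN1 !iter_addr_0 big_map.
rewrite big_enum /=.
(* An empty fiber contributes |0 - 1| = 0 + 1; the correction by 2 is needed exactly for labels in
   the image of [f]. *)
have absE i : `|(fib i)%:R - 1| =
    (fib i)%:R + 1 - 2 * (i \in f @: vertex X)%:R :> C.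
  have [/imsetP[x _ fx]|notfi] := boolP (i \in _).
    have fib_gt0 : (0 < fib i)%N by apply/card_gt0P; exists x; rewrite inE fx.
    rewrite ger0_norm ?subr_ge0 ?ler1n // mulr1 -addrA; congr (_ + _).
    by rewrite opprD addrA subrr add0r.
  suffices -> : fib i = 0%N by rewrite sub0r normrN1 mulr0 subr0 add0r.
  apply/eqP; rewrite cards_eq0; apply/set0Pn => -[x]; rewrite inE => /eqP fx.
  by case/negP: notfi; rewrite -fx imset_f.
have sum_fib : (\sum_i fib i = n)%N.
  rewrite /n -sum1_card (partition_big f xpredT) //=.
  by apply: eq_bigr => i _; rewrite /fib -sum1dep_card.
rewrite (eq_bigr _ (fun i _ => absE i)) big_split /= big_split /= -natr_sum.
rewrite sum_fib sumr_const sumrN -mulr_sumr -natr_sum -big_mkcond /= sum1_card.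
by move=> eqE; apply: (addIr #|I|%:R); rewrite eqE; ring.
Qed.

(** * Centralizers when an abelian normal subgroup has prime index *)

Section AbelianNormalPrimeIndex.
Local Open Scope group_scope.
Variables (gT : finGroupType) (G A : {group gT}).
Hypotheses (nsAG : A <| G) (abelA : abelian A) (primeAG : prime #|G : A|).
Hypothesis nabG : ~~ abelian G.

Let sAG : A \subset G := normal_sub nsAG.
Let maxA : maximal A G := p_index_maximal sAG primeAG.

(** Otherwise maximality of [A] makes [G] the product of [A] and its center, hence abelian. *)
Lemma center_sub_abelian_maximal : 'Z(G) \subset A.
Proof.
apply: contraR nabG => nsZA.
rewrite -(mulg_normal_maximal nsAG maxA (center_sub G) nsZA).
rewrite abelianM abelA center_abelian (centsS sAG) //.
exact: subsetIr.
Qed.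

(** The centralizer contains the maximal subgroup [A]; were it larger, it would be [G] and [x] would
    be central. *)
Lemma subcent1_abelian_maximal x : x \in A :\: 'Z(G) -> 'C_G[x] = A.
Proof.
case/setDP=> Ax; apply: contraNeq => neqCA.
have sAC : A \subset 'C_G[x].
  by rewrite subsetI sAG sub_cent1 (subsetP abelA).
have sCG : 'C_G[x] \subset G := subsetIl _ _.
have nsCA : ~~ ('C_G[x] \subset A).
  by apply: contraNN neqCA => sCA; rewrite eqEsubset sCA.
have := mulg_normal_maximal nsAG maxA sCG nsCA; rewrite mulSGid // => defG.
by rewrite inE (subsetP sAG) //= -sub_cent1 -defG subsetIr.
Qed.

(** By maximality [A] and [x] generate [G], so an element of [A] commuting with [x] is central. *)
Lemma subcent1_notin_abelian_maximal x : x \in G -> x \notin A ->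
  'C_G[x] :&: A = 'Z(G).
Proof.
move=> Gx notAx; apply/eqP; rewrite eqEsubset; apply/andP; split; last first.
  rewrite !subsetI center_sub sub_cent1 center_sub_abelian_maximal.
  by rewrite (subsetP _ _ Gx) // centsC subsetIr.
have nsxA : ~~ (<[x]> \subset A) by rewrite cycle_subG.
have sxG : <[x]> \subset G by rewrite cycle_subG.
have centG : 'C(G) = 'C(A) :&: 'C[x].
  rewrite -cent_cycle -centM.
  by rewrite (mulg_normal_maximal nsAG maxA sxG nsxA).
rewrite subsetI centG subsetI (subset_trans (subsetIr _ _) abelA) /=.
by rewrite -setIA subsetIl setICA subsetIl.
Qed.

(** Product formula for [A] and ['C_G[x]], whose product is [G] and whose intersection is the
    center. *)
Lemma card_subcent1_notin x : x \in G -> x \notin A ->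
  #|'C_G[x]| = (#|G : A| * #|'Z(G)|)%N.
Proof.
move=> Gx notAx; have nsCA : ~~ ('C_G[x] \subset A).
  by apply: contra notAx => /subsetP-> //; rewrite inE Gx cent1id.
have := mul_cardG A 'C_G[x].
rewrite (mulg_normal_maximal nsAG maxA (subsetIl _ _) nsCA) setIC.
rewrite (subcent1_notin_abelian_maximal Gx notAx) -(Lagrange sAG) -mulnA.
by move/eqP; rewrite eqn_pmul2l ?cardG_gt0 // => /eqP.
Qed.

(** For [x] outside [A], the quotient of ['C_G[x]] by the central subgroup ['Z(G)] has prime order,
    hence is cyclic. *)
Lemma subcent1_abelian x : x \in G :\: 'Z(G) -> abelian 'C_G[x].
Proof.
case/setDP=> Gx notZx; have [Ax|notAx] := boolP (x \in A).
  by rewrite subcent1_abelian_maximal // inE notZx.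
have sZC : 'Z(G) \subset 'C_G[x].
  by rewrite -(subcent1_notin_abelian_maximal Gx notAx) subsetIl.
apply: (@cyclic_factor_abelian _ 'Z(G)).
  rewrite subsetI sZC (subset_trans (subsetIr _ _)) // centS //.
  exact: subsetIl.
apply: prime_cyclic; rewrite card_quotient; last first.
  by rewrite (subset_trans (subsetIl _ _)) ?gFnorm.
by rewrite -divgS // card_subcent1_notin // mulnK ?cardG_gt0.
Qed.

(** Makes the centralizer a label for the clique of a vertex. Since centralizers are abelian, those
    of commuting elements contain each other. *)
Lemma subcent1_eq x y : x \in G :\: 'Z(G) -> y \in G :\: 'Z(G) ->
  ('C_G[x] == 'C_G[y]) = (y \in 'C[x]).
Proof.
have sub u v : u \in G :\: 'Z(G) -> v \in G -> v \in 'C[u] ->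
    'C_G[u] \subset 'C_G[v].
  move=> DGu Gv Cuv; rewrite subsetI subsetIl sub_cent1.
  by rewrite (subsetP (subcent1_abelian DGu)) // inE Gv.
move=> Dx Dy; have [/setDP[Gx _] /setDP[Gy _]] := (Dx, Dy).
apply/eqP/idP => [eqC | Cxy].
  have : y \in 'C_G[x] by rewrite eqC inE Gy cent1id.
  by case/setIP.
by apply/eqP; rewrite eqEsubset !sub // cent1C.
Qed.

Lemma subcent1_fiber x : x \in G :\: 'Z(G) ->
  [set y in G :\: 'Z(G) | 'C_G[y] == 'C_G[x]] = 'C_G[x] :\: 'Z(G).
Proof.
move=> Dx; apply/setP=> y; rewrite inE.
have [Dy|] := boolP (y \in G :\: 'Z(G)).
  rewrite subcent1_eq // cent1C.
  by case/setDP: Dy => Gy /negPf; rewrite !inE Gy => ->.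
by rewrite !in_setD in_setI; case: (y \in 'Z(G)); case: (y \in G).
Qed.

Lemma card_subcent1s :
  #|[set 'C_G[x] | x in G :\: 'Z(G)]| = #|A : 'Z(G)|.+1.
Proof.
have sZA := center_sub_abelian_maximal.
(* If [A] were the center, [G / 'Z(G)] would have prime order and [G] would be abelian. *)
have [a DAa] : exists a, a \in A :\: 'Z(G).
  apply/set0Pn; rewrite setD_eq0; apply: contra nabG => sAZ.
  have eqZA : 'Z(G) = A by apply/eqP; rewrite eqEsubset sZA.
  apply: (@cyclic_factor_abelian _ 'Z(G)) => //; apply: prime_cyclic.
  by move: primeAG; rewrite -eqZA card_quotient ?gFnorm.
have CA : 'C_G[a] = A := subcent1_abelian_maximal DAa.
have DGa : a \in G :\: 'Z(G) by apply: subsetP DAa; apply: setSD.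
set S := [set _ | x in _].
have SA : (A : {set gT}) \in S by apply/imsetP; exists a.
have fibE H : H \in S ->
    (\sum_(y in G :\: 'Z(G) | 'C_G[y] == H) 1 = #|H| - #|'Z(G)|)%N.
  case/imsetP=> x Dx ->; rewrite sum1dep_card subcent1_fiber // cardsDS //.
  rewrite subsetI center_sub sub_cent1; case/setDP: Dx => Gx _.
  by rewrite (subsetP _ _ Gx) // centsC subsetIr.
have otherE H : H \in S -> H != A -> #|H| = (#|G : A| * #|'Z(G)|)%N.
  case/imsetP=> x Dx ->; case/setDP: (Dx) => Gx notZx neqHA.
  apply: card_subcent1_notin => //; apply: contra neqHA => Ax.
  by rewrite subcent1_abelian_maximal // inE notZx.
(* One class comes from [A]; all the others have the same size. *)
have : (#|G :\: 'Z(G)| = (#|A| - #|'Z(G)|)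
          + #|S|.-1 * (#|G : A| * #|'Z(G)| - #|'Z(G)|))%N.
  rewrite -sum1_card (partition_big_imset (fun x => 'C_G[x])) -/S /=.
  rewrite (eq_bigr _ fibE) (bigD1 _ SA) /=; congr (_ + _)%N.
  rewrite (eq_bigr (fun=> #|G : A| * #|'Z(G)| - #|'Z(G)|)%N); last first.
    by move=> H /andP[SH neqHA]; rewrite otherE.
  rewrite sum_nat_const; congr (_ * _)%N.
  rewrite (cardsD1 (A : {set gT}) S) SA.
  by apply: eq_card => H; rewrite !inE andbC.
have S_gt0 : (0 < #|S|)%N by apply/card_gt0P; exists (A : {set gT}).
rewrite cardsDS ?center_sub // -(Lagrange sAG) -(Lagrange sZA).
have := prime_gt1 primeAG; have := cardG_gt0 'Z(G); have := indexg_gt0 A 'Z(G).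
move: S_gt0; set s := #|S|; set z := #|'Z(G)|; set k := #|A : _|.
set p := #|G : A|.
(* Now [s] counts the classes other than that of [A]. With [p = q + 1], adding [z] back removes the
   truncated subtractions and leaves [z * k * q = s * z * q], whence [s = k]. *)
clear; case: s => // s _ k_gt0 z_gt0 p_gt1 /= eqn; congr _.+1.
apply/eqP; move: eqn p_gt1; case: p => // q eqn q_gt0.
rewrite -(eqn_pmul2l z_gt0) -(eqn_pmul2r q_gt0) eq_sym; apply/eqP.
have le_z_zk : (z <= z * k)%N by rewrite leq_pmulr.
have := congr1 (addn^~ z) eqn; rewrite /= subnK; last first.
  by rewrite (leq_trans le_z_zk) // leq_pmulr.
rewrite addnAC subnK // mulSn addKn mulnS => /addnI ->.
by rewrite mulnA mulnAC [(s * z)%N]mulnC mulnAC.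
Qed.

Lemma energy_commuting_graph (C : numClosedFieldType) :
  energy C (commuting_graph G) =
    (2 * (#|G|%:R - #|'Z(G)|%:R - #|A : 'Z(G)|.+1%:R))%R.
Proof.
rewrite (@energy_cluster_graph C (commuting_graph G) _
           (fun x : noncentral G => 'C_G[val x])); last first.
  move=> x y; rewrite /commuting_adj (subcent1_eq (valP x) (valP y)).
  by rewrite cent1C cent1E.
rewrite -card_subcent1s -[in RHS]natrB ?subset_leq_card ?center_sub //.
rewrite -cardsDS ?center_sub // card_sig; congr (2 * (_%:R - _%:R))%R.
congr #|(_ : {set _})|; apply/setP=> H; apply/imsetP/imsetP => -[x].
  by move=> _ ->; exists (val x) => //; apply: valP.
by move=> Dx ->; exists (Sub x Dx).
Qed.

End AbelianNormalPrimeIndex.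

(** * Transfer to the central quotient *)

Section CyclicNormalOfCentralQuotient.
Local Open Scope group_scope.
Variables (gT : finGroupType) (G : {group gT}) (B : {group coset_of 'Z(G)}).
Hypotheses (nsBQ : B <| G / 'Z(G)) (cycB : cyclic B).
Hypothesis primeBQ : prime #|G / 'Z(G) : B|.

(** The preimage [A] of [B] is abelian, being cyclic modulo a central subgroup, and it keeps the
    prime index of [B]. The bound on [#|B|] rules out an abelian [G], whose central quotient is
    trivial. *)
Lemma energy_commuting_graph_quotient (C : numClosedFieldType) :
    (1 < #|B|)%N ->
  energy C (commuting_graph G) =
    (2 * ((#|(G / 'Z(G))%g|%:R - 1) * #|'Z(G)|%:R - #|B|%:R - 1))%R.
Proof.
move=> B_gt1; pose A := coset 'Z(G) @*^-1 B.
have defG : coset 'Z(G) @*^-1 (G / 'Z(G)) = G.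
  by rewrite quotientGK ?center_normal.
have sZA : 'Z(G) \subset A := sub_cosetpre _.
have nsAG : A <| G by rewrite -defG cosetpre_normal.
have abelA : abelian A.
  apply: (@cyclic_factor_abelian _ 'Z(G)); last by rewrite cosetpreK.
  rewrite subsetI sZA (subset_trans (subsetIr G _)) // centS //.
  exact: normal_sub.
have indexAG : #|G : A| = #|G / 'Z(G) : B|.
  by rewrite -[in LHS]defG index_cosetpre.
have indexZA : #|A : 'Z(G)| = #|B|.
  by rewrite -divgS //= card_cosetpre mulKn ?cardG_gt0.
have nabG : ~~ abelian G.
  apply: contraTN B_gt1 => /center_idP eqZ; rewrite -leqNgt.
  rewrite (leq_trans (subset_leq_card (normal_sub nsBQ))) // eqZ.
  by rewrite trivg_quotient cards1.
rewrite (energy_commuting_graph nsAG abelA) ?indexAG // indexZA.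
rewrite -(Lagrange (center_sub G)) -card_quotient ?gFnorm // natrM -natr1.
by ring.
Qed.

End CyclicNormalOfCentralQuotient.

(** The presentation covers the Klein group [m = 2] as well. Its relations only bound the orders of
    [x] and [y] by [m] and 2; as [<[x]> * <[y]>] has [2 * m] elements, [x] has order exactly [m]. *)
Lemma dihedral_cyclic_index2 (gT : finGroupType) (Q : {group gT}) m :
    (1 < m)%N -> (Q \isog 'D_(2 * m)%N)%g ->
  #|Q| = (2 * m)%N /\
  exists B : {group gT}, [/\ B \subset Q, cyclic B & #|B| = m].
Proof.
move=> m_gt1; rewrite mul2n.
case/(isoGrpP _ (Grp_dihedral m_gt1)); rewrite card_dihedral // -mul2n => oQ.
case/existsP=> -[x y] /= /eqP[defQ xm y2 xy]; split=> //.
have{} defQ : (<[x]> * <[y]>)%g = Q.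
  by rewrite -norm_joinEr // norms_cycle xy groupV cycle_id.
have sxQ : (<[x]> \subset Q)%g by rewrite -defQ mulG_subl.
exists <[x]>%G; split=> //; first exact: cycle_cyclic.
have ox : (#[x]%g <= m)%N by rewrite dvdn_leq ?order_dvdn ?xm // ltnW.
have oy : (#[y]%g <= 2)%N by rewrite dvdn_leq ?order_dvdn ?y2.
apply/eqP; rewrite eqn_leq ox /= -(leq_pmul2l (isT : 0 < 2)%N) -oQ -defQ.
apply: leq_trans (_ : #|<[x]>%g| * #|<[y]>%g| <= _)%N.
  by rewrite mul_cardG leq_pmulr ?cardG_gt0.
by rewrite mulnC leq_mul2r oy orbT.
Qed.

Theorem theorem3 (C : numClosedFieldType) (gT : finGroupType) (G : {group gT}) :
  (forall p : nat, prime p ->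
     (G / 'Z(G) \isog [set: 'Z_p * 'Z_p])%g ->
     energy C (commuting_graph G) =
       2 * ((p%:R ^+ 2 - 1) * #|'Z(G)%g|%:R - p%:R - 1))
  /\
  (forall m : nat, (2 <= m)%N ->
     (G / 'Z(G) \isog 'D_(2 * m)%N)%g ->
     energy C (commuting_graph G) =
       2 * ((2 * m%:R - 1) * #|'Z(G)%g|%:R - m%:R - 1)).
Proof.
split=> [p p_pr /card_isog oQ | m m_gt1 /(dihedral_cyclic_index2 m_gt1)].
  have {}oQ : #|(G / 'Z(G))%g| = (p ^ 2)%N.
    by rewrite oQ cardsT card_prod card_ord Zp_cast ?prime_gt1 // mulnn.
  (* [<[x]>] serves as [B]: it has order and index [p], and is normal because a group of order
     [p ^ 2] is abelian. *)
  have [|x Qx ox] := @Cauchy _ p (G / 'Z(G))%G p_pr.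
    by rewrite oQ dvdn_mulr.
  have sxQ : (<[x]> \subset G / 'Z(G))%g by rewrite cycle_subG.
  rewrite (@energy_commuting_graph_quotient _ _ <[x]>%G) ?cycle_cyclic //=.
  - by rewrite oQ -orderE ox natrX.
  - rewrite -sub_abelian_normal //; exact: card_p2group_abelian oQ.
  - by rewrite -divgS // oQ -orderE ox mulKn ?prime_gt0.
  by rewrite -orderE ox prime_gt1.
case=> oQ [B [sBQ cycB oB]].
(* Index 2 yields both normality of [B] and primality of its index. *)
have indexB : #|G / 'Z(G) : B|%g = 2%N.
  by rewrite -divgS // oQ oB mulnK // ltnW.
rewrite (energy_commuting_graph_quotient (index2_normal sBQ indexB) cycB).
- by rewrite oQ oB natrM.
- by rewrite indexB.
by rewrite oB.
Qed.
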